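(* The inversion in the unit sphere $$\phi : \mathbb{R}^{n}\setminus\{0\} \to \mathbb{R}^n,\qquad x \mapsto \frac{x}{|x|^2}$$ is a biharmonic morphism if and only if $n=4$.
   Context: $\mathbb R^n$ and $\mathbb R^n\setminus\{0\}$ carry the Euclidean metric. A real function $f$ on an open set of a Riemannian manifold is biharmonic if $\Delta^2 f=\Delta(\Delta f)=0$, where $\Delta f=\mathrm{trace}\,\nabla df$. A continuous map $\phi:(M,g)\to(N,h)$ between Riemannian manifolds is a biharmonic morphism if for every biharmonic function $f:U\subset N\to\mathbb R$ ($U$ open) with $\phi^{-1}(U)\neq\emptyset$, the function $f\circ\phi:\phi^{-1}(U)\to\mathbb R$ is biharmonic. *)

(* Defs.v *)
From HB Require Import structures.
From mathcomp Require Import all_boot all_order all_algebra.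
From mathcomp Require Import all_classical all_reals all_analysis.

Set Implicit Arguments.
Unset Strict Implicit.
Unset Printing Implicit Defensive.

Import Order.TTheory GRing.Theory Num.Theory.
Import numFieldNormedType.Exports.

Local Open Scope classical_set_scope.
Local Open Scope ring_scope.

(* The library norm `|x| on 'rV[R]_n is the sup norm. It induces the usual
   topology and the usual notion of differentiability, but |x| in the inversion
   is the Euclidean norm. *)
Definition enorm (R : realType) (n : nat) (x : 'rV[R]_n) : R :=
  Num.sqrt (\sum_(i < n) x 0 i ^+ 2).

Definition partial (R : realType) (n : nat) (i : 'I_n) (f : 'rV[R]_n -> R) :
  'rV[R]_n -> R := fun x => 'D_(delta_mx 0 i) f x.

(* f is of class C^k on U. Functions on an open U are represented by total
   functions: every notion below depends, for U open, only on the values of f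
   on U. *)
Fixpoint class_C (R : realType) (n : nat) (k : nat) (U : set 'rV[R]_n)
    (f : 'rV[R]_n -> R) : Prop :=
  if k is k'.+1 then
    (forall x, U x -> differentiable f x) /\
    (forall i : 'I_n, class_C k' U (partial i f))
  else {in U, continuous f}.

(* Matrix of the Euclidean second covariant derivative (nabla df) at x in the
   standard orthonormal frame. *)
Definition hessian (R : realType) (n : nat) (f : 'rV[R]_n -> R)
    (x : 'rV[R]_n) : 'M[R]_n :=
  \matrix_(i < n, j < n) partial i (partial j f) x.

Definition laplacian (R : realType) (n : nat) (f : 'rV[R]_n -> R) :
  'rV[R]_n -> R := fun x => \tr (hessian f x).

(* U is meant to be open. Class C^4 is what makes the iterated Laplacian
   classically defined; by elliptic regularity such an f is smooth. *)
Definition biharmonic (R : realType) (n : nat) (U : set 'rV[R]_n)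
    (f : 'rV[R]_n -> R) : Prop :=
  class_C 4 U f /\ forall x, U x -> laplacian (laplacian f) x = 0.

(* M and N are meant to be open; the map M -> N is the restriction of phi. *)
Definition biharmonic_morphism (R : realType) (m n : nat)
    (M : set 'rV[R]_m) (N : set 'rV[R]_n) (phi : 'rV[R]_m -> 'rV[R]_n) : Prop :=
  [/\ forall x, M x -> N (phi x),
      {within M, continuous phi} &
      forall (U : set 'rV[R]_n) (f : 'rV[R]_n -> R),
        open U -> U `<=` N -> biharmonic U f ->
        M `&` phi @^-1` U !=set0 ->
        biharmonic (M `&` phi @^-1` U) (f \o phi)].

Definition inversion (R : realType) (n : nat) (x : 'rV[R]_n) : 'rV[R]_n :=
  (enorm x ^+ 2)^-1 *: x.

(* Main.v *)
(** Write s = |y|^2, E = \sum_k y_k d_k for the Euler operator and phi for the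
inversion. Since the Jacobian of phi is s I - 2 y y^T when expressed at the
image point y, d_i (f \o phi) = (D_i f) \o phi where D_i = s d_i - 2 y_i E
([special_conformal i]) generates the special conformal transformations.
Hence f \o phi is as smooth as f, and its Laplacian is (L f) \o phi with
  L = \sum_i D_i^2 = s^2 Lap + (4 - 2 n) s E   ([inverted_laplacian]).
The commutation relations [Lap, E] = 2 Lap, [E, s] = 2 s, [Lap, s] = 4 E + 2 n
give
  L^2 = s^4 Lap^2
        + (4 - n) (4 s^3 E Lap + 8 s^3 Lap + 2 (4 - 2 n) s^2 (E^2 + E)),
so that L^2 = s^4 Lap^2 when n = 4. Conversely, for the biharmonic function
f = s + y_i one finds L^2 f = 16 (4 - n)^2 at the basis vector e_i. *)

Require Import Defs.
From mathcomp Require Import all_boot all_order all_algebra.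
From mathcomp Require Import all_classical all_reals all_analysis.
From mathcomp Require Import ring.
Local Open Scope classical_set_scope.

Set Implicit Arguments.
Unset Strict Implicit.
Unset Printing Implicit Defensive.

Import Order.TTheory GRing.Theory Num.Theory.
Import numFieldNormedType.Exports.

Local Open Scope ring_scope.

(** Differentiability at [a] amounts to a first-order expansion at [a], which only sees germs: the
    expansion of [f] serves for [g], and uniqueness of the differential identifies ['d g a] with
    ['d f a]. *)
Lemma near_eq_differentiable (R : numFieldType) (V W : normedModType R)
    (f g : V -> W) (a : V) :
  (\near a, f a = g a) -> differentiable f a -> differentiable g a.
Proof.
move=> fg /diff_locallyP[cdf /eqaddoP fE].
have gE : g \o shift a = cst (g a) + 'd f a +o_ (0 : V) id.
  apply/eqaddoP => e e0; have := fE e e0.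
  have fg0 : \forall x \near (0 : V), f (x + a) = g (x + a).
    by move/nbhs0P: fg; apply: filterS => x; rewrite addrC.
  (* The constant terms of the two expansions agree because a neighbourhood of [a] contains [a]. *)
  have fga : f a = g a by exact: (nbhs_singleton fg).
  apply: filter_app; near do rewrite -fga.
  by move: fg0; apply: filterS => x /= fgx; rewrite !fctE /= fgx.
have dg : 'd g a = 'd f a :> (V -> W) by exact: diff_unique.
by apply/diff_locallyP; rewrite dg.
Unshelve. all: by end_near. Qed.

(** * Functions of class C^k *)

Section ClassC.
Context {R : realType} {n : nat}.
Notation V := 'rV[R]_n.
Implicit Types (f g : V -> R) (U : set V) (x : V) (i j : 'I_n).

Lemma partial_eq_on U f g i x : open U -> (forall y, U y -> f y = g y) -> U x ->
  partial i f x = partial i g x.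
Proof.
move=> oU fg Ux; rewrite /partial; apply: near_eq_derive.
by move: (open_nbhs_nbhs (conj oU Ux)); apply: filterS.
Qed.

(** Openness of [U] lets the agreement pass to the partial derivatives, so the induction has to
    range over all pairs [f], [g]. This is what allows a partial derivative to be replaced by a
    formula valid on [U] only. *)
Lemma class_C_eq_on k U f g : open U -> (forall x, U x -> f x = g x) ->
  class_C k U f -> class_C k U g.
Proof.
move=> oU; elim: k f g => [|k IH] f g fg /=.
  move=> cf x xU; have Ux := set_mem xU.
  have Un := open_nbhs_nbhs (conj oU Ux).
  rewrite /prop_for /continuous_at -fg//.
  apply: cvg_trans (cf x xU); apply: (@near_eq_cvg _ _ (nbhs x)).
  by move: Un; apply: filterS => y /fg.
move=> [df cf]; split=> [x Ux|i].
  apply: near_eq_differentiable (df x Ux).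
  by move: (open_nbhs_nbhs (conj oU Ux)); apply: filterS.
by apply: IH (cf i) => x Ux; exact: partial_eq_on Ux.
Qed.

Lemma class_C_differentiable k U f x : class_C k.+1 U f -> U x ->
  differentiable f x.
Proof. by move=> [+ _]; apply. Qed.

Lemma class_C_partial k U f i : class_C k.+1 U f -> class_C k U (partial i f).
Proof. by move=> [_]; apply. Qed.

Lemma class_C_pred k U f : class_C k.+1 U f -> class_C k U f.
Proof.
elim: k f => [|k IH] f [df cf].
  by move=> x xU; apply/differentiable_continuous/df/set_mem.
by split=> // i; apply: IH.
Qed.

Lemma class_C_le m k U f : (m <= k)%N -> class_C k U f -> class_C m U f.
Proof.
move=> /subnK <-; elim: (k - m)%N => [//|d IH]; rewrite addSn => cf.
exact/IH/class_C_pred.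
Qed.

Lemma class_C_continuous k U f x : class_C k U f -> U x ->
  {for x, continuous f}.
Proof. by move=> /(class_C_le (leq0n k)) cf /mem_set; exact: cf. Qed.

Lemma class_C_is_derive k U f i x : class_C k.+1 U f -> U x ->
  is_derive x (delta_mx 0 i : V) f (partial i f x).
Proof.
by move=> cf Ux; apply/derivableP/diff_derivable/(class_C_differentiable cf Ux).
Qed.

Lemma partial_cst (a : R) i : partial i (cst a : V -> R) = cst 0.
Proof. by apply/funext => x; rewrite /partial derive_cst. Qed.

Lemma class_C_cst k U (a : R) : class_C k U (cst a).
Proof.
elim: k a => [|k IH] a /=; first by move=> x _; exact: cst_continuous.
split=> [x _|i]; [exact: differentiable_cst|rewrite partial_cst; exact: IH].
Qed.

Lemma class_C_add k U f g : open U -> class_C k U f -> class_C k U g ->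
  class_C k U (f + g).
Proof.
move=> oU; elim: k f g => [|k IH] f g cf cg.
  by move=> x xU; apply: continuousD; [exact: cf|exact: cg].
split=> [x Ux|i].
  by apply: differentiableD; [case: cf|case: cg] => + _; apply.
apply: (@class_C_eq_on _ _ (partial i f + partial i g)) => // [x Ux|].
  have ? := class_C_is_derive i cf Ux; have ? := class_C_is_derive i cg Ux.
  by rewrite [RHS]derive_val.
by apply: IH; exact: class_C_partial.
Qed.

Lemma class_C_mul k U f g : open U -> class_C k U f -> class_C k U g ->
  class_C k U (f * g).
Proof.
move=> oU; elim: k f g => [|k IH] f g cf cg.
  by move=> x xU; apply: continuousM; [exact: cf|exact: cg].
split=> [x Ux|i].
  by apply: differentiableM; [case: cf|case: cg] => + _; apply.
(* The Leibniz formula holds only on [U], where [f] and [g] are known to be differentiable. *)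
apply: (@class_C_eq_on _ _ (f * partial i g + g * partial i f)) => // [x Ux|].
  have ? := class_C_is_derive i cf Ux; have ? := class_C_is_derive i cg Ux.
  by rewrite [RHS]derive_val.
by apply: class_C_add => //; apply: IH;
   do ?[exact: class_C_pred|exact: class_C_partial].
Qed.

Lemma class_C_sum k U m (f : 'I_m -> V -> R) : open U ->
  (forall l, class_C k U (f l)) -> class_C k U (\sum_(l < m) f l).
Proof.
move=> oU cf; elim/big_ind: _ => //; first exact: class_C_cst.
by move=> *; exact: class_C_add.
Qed.

(** Coordinates as elements of the ring of functions, so that differential operators with polynomial
    coefficients are plain ring expressions. *)
Definition crd i : V -> R := fun x => x 0 i.

Global Instance is_derive_crd j x (v : V) : is_derive x v (crd j) (v 0 j).
Proof.
apply: DeriveDef; first exact/diff_derivable/differentiable_coord.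
have := derive_mx (@derivable_id _ _ x v); rewrite derive_id.
by move=> /matrixP/(_ 0 j); rewrite mxE => ->.
Qed.

Lemma partial_crd i j : partial i (crd j) = cst (i == j)%:R.
Proof. by apply/funext => x; rewrite /partial derive_val mxE eqxx eq_sym. Qed.

Lemma class_C_crd k U j : class_C k U (crd j).
Proof.
case: k => [|k]; first by move=> x _; exact: coord_continuous.
split=> [x _|i]; first exact: differentiable_coord.
by rewrite partial_crd; exact: class_C_cst.
Qed.

End ClassC.

(** * Symmetry of second derivatives *)

Section Schwarz.
Context {R : realType} {V : normedModType R}.
Implicit Types (f : V -> R) (x u v : V).

(** The difference quotient of the restriction to the line at [t] is literally that of [f] at
    [x + t *: v] along [v]. *)
Lemma is_derive_line f x v (t df : R) :
  is_derive (x + t *: v) v f df ->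
  is_derive t 1 (fun s : R => f (x + s *: v)) df.
Proof.
have E : (fun h : R => h^-1 *: (((fun s : R => f (x + s *: v)) \o shift t)
    (h *: (1 : R)) - f (x + t *: v))) =
  (fun h => h^-1 *: ((f \o shift (x + t *: v)) (h *: v) - f (x + t *: v))).
  apply/funext => h /=; congr (_ *: (f _ - _)).
  by rewrite scalerDl [h%:A]mulr1 addrCA.
by move=> [df1 df2]; apply: DeriveDef; rewrite /derivable /derive E.
Qed.

Lemma mean_value_line f x v (t : R) : 0 < t ->
  (forall s, 0 <= s <= t -> derivable f (x + s *: v) v) ->
  exists2 s, 0 <= s <= t & f (x + t *: v) - f x = t * 'D_v f (x + s *: v).
Proof.
move=> t0 df; pose g (s : R) := f (x + s *: v).
have dg s : 0 <= s <= t -> is_derive s 1 g ('D_v f (x + s *: v)).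
  by move=> /df /derivableP; exact: is_derive_line.
have dg' s : s \in `]0, t[%R -> is_derive s 1 g ('D_v f (x + s *: v)).
  by rewrite in_itv /= => /andP[s0 st]; apply: dg; rewrite !ltW.
have cg : {within `[0, t], continuous g}.
  apply: derivable_within_continuous => s.
  by rewrite in_itv /= => /dg[].
have [s] := MVT t0 dg' cg.
rewrite in_itv /= => /andP[s0 st].
rewrite /g scale0r addr0 subr0 mulrC => ->.
by exists s => //; rewrite !ltW.
Qed.

Lemma is_derive_translate f x v w (df : R) :
  is_derive (x + w) v f df -> is_derive x v (f \o shift w) df.
Proof.
have E : (fun h : R => h^-1 *: (((f \o shift w) \o shift x)
    (h *: v) - (f \o shift w) x)) =
  (fun h => h^-1 *: ((f \o shift (x + w)) (h *: v) - f (x + w))).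
  by apply/funext => h /=; rewrite addrA.
by move=> [df1 df2]; apply: DeriveDef; rewrite /derivable /derive E.
Qed.

(* The mean value theorem is applied first along u, then along v. *)
Lemma second_difference f x u v (t : R) : 0 < t ->
  (forall a b, 0 <= a <= t -> 0 <= b <= t ->
    derivable f (x + a *: u + b *: v) u /\
    derivable ('D_u f) (x + a *: u + b *: v) v) ->
  exists a b, [/\ 0 <= a <= t, 0 <= b <= t &
    f (x + t *: u + t *: v) - f (x + t *: u) - f (x + t *: v) + f x =
    t ^+ 2 * 'D_v ('D_u f) (x + a *: u + b *: v)].
Proof.
(* The second difference of [f] is the increment along [u] of [g], itself an increment along [v]. *)
move=> t0 df; pose g (y : V) := f (y + t *: v) - f y.
have t0t : 0 <= t <= t by rewrite lexx ltW.
have t00 : (0 : R) <= 0 <= t by rewrite lexx ltW.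
have dg a : 0 <= a <= t -> is_derive (x + a *: u) u g
    ('D_u f (x + a *: u + t *: v) - 'D_u f (x + a *: u)).
  move=> at0; have [/derivableP d1 _] := df a t at0 t0t.
  have [/derivableP d2 _] := df a 0 at0 t00; rewrite scale0r addr0 in d2.
  by have ? := is_derive_translate d1; exact: is_deriveB.
have [a at0 ga] := @mean_value_line g x u t t0
  (fun a h => let: DeriveDef d _ := dg a h in d).
have [b bt0 gb] := @mean_value_line ('D_u f) (x + a *: u) v t t0
  (fun b h => (df a b at0 h).2).
exists a, b; split => //.
rewrite expr2 -mulrA -gb -(let: DeriveDef _ d := dg a at0 in d) -ga /g.
by rewrite opprB !addrA addrAC.
Qed.

(** The second difference is symmetric in [u] and [v]. Divided by t^2, it is a value of either mixed
    derivative at some point close to [x], and continuity at [x] makes the two limits equal. *)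
Lemma derive_comm f x u v :
  (\forall y \near x, [/\ derivable f y u, derivable f y v,
    derivable ('D_u f) y v & derivable ('D_v f) y u]) ->
  {for x, continuous ('D_v ('D_u f))} -> {for x, continuous ('D_u ('D_v f))} ->
  'D_u ('D_v f) x = 'D_v ('D_u f) x.
Proof.
move=> df cvu cuv; apply/eqP; rewrite -subr_eq0 -normr_le0.
apply/ler_addgt0Pr => e e0; rewrite add0r.
have e20 : 0 < e / 2 by rewrite divr_gt0.
move/cvgrPdist_lt/(_ _ e20) : cvu => cvu.
move/cvgrPdist_lt/(_ _ e20) : cuv => cuv.
have [r /= r0 Br] := (nbhs_ballP _ _).1 (filterI df (filterI cvu cuv)).
(* With this [t], the norm of a u + b v is at most t (|u| + |v|) < r for [a], [b] in [0, t]; the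
   summand 1 makes the bound strict and the denominator positive. *)
pose t := r / (1 + `|u| + `|v|).
have d0 : 0 < 1 + `|u| + `|v| by rewrite -addrA ltr_pwDl// addr_ge0.
have t0 : 0 < t by rewrite divr_gt0.
have near_x a b : 0 <= a <= t -> 0 <= b <= t -> ball x r (x + a *: u + b *: v).
  move=> /andP[a0 at_] /andP[b0 bt].
  rewrite -ball_normE /= opprD addrA opprD addrA subrr sub0r -opprD normrN.
  apply: le_lt_trans (ler_normD _ _) _; rewrite !normrZ !ger0_norm//.
  apply: (@le_lt_trans _ _ (t * (`|u| + `|v|))).
    by rewrite mulrDr lerD// ler_wpM2r.
  by rewrite /t mulrAC ltr_pdivrMr// ltr_pM2l// -addrA ltrDr.
have [a [b [at0 bt0 E1]]] := @second_difference f x u v t t0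
  (fun a b ha hb =>
    let: conj (And4 p1 _ p3 _) _ := Br _ (near_x a b ha hb) in conj p1 p3).
have near_x' a' b' : 0 <= a' <= t -> 0 <= b' <= t ->
  ball x r (x + a' *: v + b' *: u).
  by move=> ? ?; rewrite addrAC; exact: near_x.
have [a' [b' [at0' bt0' E2]]] := @second_difference f x v u t t0
  (fun a b ha hb =>
    let: conj (And4 _ p1 _ p3) _ := Br _ (near_x' a b ha hb) in conj p1 p3).
have [_ [/= h1 _]] := Br _ (near_x _ _ at0 bt0).
have [_ [_ /= h2]] := Br _ (near_x' _ _ at0' bt0').
move: h1 h2 E1 E2; rewrite (addrAC x (t *: v)).
move: ('D_v ('D_u f) (x + a *: u + b *: v)) => A.
move: ('D_u ('D_v f) (x + a' *: v + b' *: u)) => A'.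
move: ('D_v ('D_u f) x) ('D_u ('D_v f) x) => B B' AB AB' E1 E2.
(* Multiplied by t^2, both intermediate values give the same second difference. *)
have E : A = A'.
  apply: (@mulfI _ (t ^+ 2)); first by rewrite expf_neq0// gt_eqF.
  by rewrite -E1 -E2; ring.
rewrite E in AB.
rewrite (le_trans (ler_distD A' _ _))//.
by rewrite ltW// (splitr e) ltrD// distrC.
Qed.
End Schwarz.

(** * The Laplacian and the Euler operator *)

Arguments class_C : simpl never.

Section Operators.
Context {R : realType} {n : nat}.
Notation V := 'rV[R]_n.
Implicit Types (f g : V -> R) (x : V) (i j : 'I_n).

(** The squared Euclidean norm in polynomial form: it is smooth everywhere, including at the origin
    where [enorm] is not. *)
Definition sqn : V -> R := \sum_(i < n) crd i * crd i.
Definition euler f : V -> R := \sum_(i < n) crd i * partial i f.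

Lemma sqnE x : sqn x = \sum_(i < n) x 0 i ^+ 2.
Proof. by rewrite /sqn fct_sumE. Qed.

Lemma eulerE f x : euler f x = \sum_(i < n) x 0 i * partial i f x.
Proof. by rewrite /euler fct_sumE. Qed.

Lemma laplacianE f x :
  laplacian f x = \sum_(i < n) partial i (partial i f) x.
Proof.
by rewrite /laplacian /mxtrace; apply: eq_bigr => i _; rewrite mxE.
Qed.

Lemma laplacian_sum f : laplacian f = \sum_(i < n) partial i (partial i f).
Proof. by apply/funext => x; rewrite laplacianE fct_sumE. Qed.

Lemma sum_delta i (F : 'I_n -> R) : \sum_(j < n) F j * (j == i)%:R = F i.
Proof.
rewrite (bigD1 i)//= eqxx mulr1 big1 ?addr0// => j /negbTE ->.
by rewrite mulr0.
Qed.

Global Instance is_derive_sqn i x :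
  is_derive x (delta_mx 0 i : V) sqn (2 * x 0 i).
Proof.
apply: is_derive_eq; under eq_bigr do rewrite mxE eqxx/=.
rewrite -(sum_delta i (fun j => 2 * x 0 j)); apply: eq_bigr => j _.
by rewrite /GRing.scale/= /crd; ring.
Qed.

Lemma partial_sqn i x : partial i sqn x = 2 * x 0 i.
Proof. by rewrite /partial derive_val. Qed.

Variable U : set V.
Hypothesis oU : open U.

Lemma class_C_sqn k : class_C k U sqn.
Proof.
by apply: class_C_sum => // i; apply: class_C_mul => //; exact: class_C_crd.
Qed.

Lemma class_C_euler k f : class_C k.+1 U f -> class_C k U (euler f).
Proof.
move=> cf; apply: class_C_sum => // i; apply: class_C_mul => //.
  exact: class_C_crd.
exact: class_C_partial.
Qed.

Lemma class_C_laplacian k f : class_C k.+2 U f -> class_C k U (laplacian f).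
Proof.
move=> cf; rewrite laplacian_sum; apply: class_C_sum => // i.
exact/class_C_partial/class_C_partial.
Qed.

End Operators.

(** Regularity is read off the syntax of the function: each differential operator raises the order
    demanded of its argument, and at a leaf a hypothesis of possibly higher order is weakened by
    [class_C_le]. *)
Ltac solve_class_C := lazymatch goal with
  | H : class_C _ ?U ?f |- class_C _ ?U ?f => by apply: class_C_le H
  | |- class_C _ _ (_ + _) =>
      apply: class_C_add; [assumption|solve_class_C|solve_class_C]
  | |- class_C _ _ (_ * _) =>
      apply: class_C_mul; [assumption|solve_class_C|solve_class_C]
  | |- class_C _ _ (cst _) => exact: class_C_cst
  | |- class_C _ _ (crd _) => exact: class_C_crd
  | |- class_C _ _ sqn => apply: class_C_sqn; assumption
  | |- class_C _ _ (partial _ _) => apply: class_C_partial; solve_class_C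
  | |- class_C _ _ (euler _) =>
      apply: class_C_euler; [assumption|solve_class_C]
  | |- class_C _ _ (laplacian _) =>
      apply: class_C_laplacian; [assumption|solve_class_C]
  end.

(** * Leibniz rules and commutation relations on an open set *)

Section OperatorIdentities.
Context {R : realType} {n : nat} {U : set 'rV[R]_n}.
Hypothesis oU : open U.
Notation V := 'rV[R]_n.
Implicit Types (f g : V -> R) (x : V) (i j : 'I_n).

Lemma partial_add f g i x : class_C 1 U f -> class_C 1 U g -> U x ->
  partial i (f + g) x = partial i f x + partial i g x.
Proof.
move=> cf cg Ux.
have df := class_C_is_derive i cf Ux; have dg := class_C_is_derive i cg Ux.
by have [] := is_deriveD df dg.
Qed.

Lemma partial_mul f g i x : class_C 1 U f -> class_C 1 U g -> U x ->
  partial i (f * g) x = f x * partial i g x + g x * partial i f x.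
Proof.
move=> cf cg Ux.
have df := class_C_is_derive i cf Ux; have dg := class_C_is_derive i cg Ux.
by have [] := is_deriveM df dg.
Qed.

Lemma partial_sum m (f : 'I_m -> V -> R) i x : (forall l, class_C 1 U (f l)) ->
  U x -> partial i (\sum_(l < m) f l) x = \sum_(l < m) partial i (f l) x.
Proof.
move=> cf Ux; have df l := class_C_is_derive i (cf l) Ux.
by have [] := is_derive_sum df.
Qed.

Lemma laplacian_eq_on f g x : (forall y, U y -> f y = g y) -> U x ->
  laplacian f x = laplacian g x.
Proof.
move=> fg Ux; rewrite !laplacianE; apply: eq_bigr => i _.
by apply: (partial_eq_on _ oU _ Ux) => y; exact: partial_eq_on.
Qed.

Lemma euler_add f g x : class_C 1 U f -> class_C 1 U g -> U x ->
  euler (f + g) x = euler f x + euler g x.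
Proof.
move=> cf cg Ux; rewrite !eulerE -big_split/=; apply: eq_bigr => i _.
by rewrite -mulrDr partial_add.
Qed.

Lemma euler_mul f g x : class_C 1 U f -> class_C 1 U g -> U x ->
  euler (f * g) x = f x * euler g x + g x * euler f x.
Proof.
move=> cf cg Ux; rewrite !eulerE !mulr_sumr -big_split/=; apply: eq_bigr => i _.
by rewrite partial_mul//; ring.
Qed.

Lemma euler_sum m (f : 'I_m -> V -> R) x : (forall l, class_C 1 U (f l)) ->
  U x -> euler (\sum_(l < m) f l) x = \sum_(l < m) euler (f l) x.
Proof.
move=> cf Ux; rewrite eulerE; under [RHS]eq_bigr do rewrite eulerE.
rewrite exchange_big/=; apply: eq_bigr => i _; rewrite -mulr_sumr.
by rewrite partial_sum.
Qed.

Lemma euler_cst (a : R) x : euler (cst a) x = 0.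
Proof. by rewrite eulerE big1// => i _; rewrite partial_cst mulr0. Qed.

Lemma euler_crd i x : euler (crd i) x = x 0 i.
Proof.
by rewrite eulerE -[RHS](sum_delta i); apply: eq_bigr => j _;
   rewrite partial_crd.
Qed.

Lemma euler_sqn x : euler sqn x = 2 * sqn x.
Proof.
rewrite eulerE sqnE mulr_sumr; apply: eq_bigr => i _.
by rewrite /partial derive_val; ring.
Qed.

Lemma laplacian_add f g x : class_C 2 U f -> class_C 2 U g -> U x ->
  laplacian (f + g) x = laplacian f x + laplacian g x.
Proof.
move=> cf cg Ux; rewrite !laplacianE -big_split/=.
apply: eq_bigr => i _.
rewrite (@partial_eq_on _ _ U _ (partial i f + partial i g))// => [|y Uy].
  by rewrite partial_add//; solve_class_C.
by rewrite partial_add//; solve_class_C.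
Qed.

Lemma laplacian_scale (a : R) f x : class_C 2 U f -> U x ->
  laplacian (cst a * f) x = a * laplacian f x.
Proof.
move=> cf Ux; rewrite !laplacianE mulr_sumr.
apply: eq_bigr => i _.
rewrite (@partial_eq_on _ _ U _ (cst a * partial i f))// => [|y Uy].
  by rewrite partial_mul ?partial_cst/= ?mulr0 ?addr0//; solve_class_C.
by rewrite partial_mul ?partial_cst/= ?mulr0 ?addr0//; solve_class_C.
Qed.

Lemma laplacian_sqn_mul f x : class_C 2 U f -> U x ->
  laplacian (sqn * f) x =
  sqn x * laplacian f x + 4 * euler f x + 2 * n%:R * f x.
Proof.
move=> cf Ux; rewrite !laplacianE eulerE !mulr_sumr.
(* Spreading the zeroth-order term over the [n] indices makes the identity hold summand by
   summand. *)
have -> : 2 * n%:R * f x = \sum_(i < n) 2 * f x.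
  by rewrite sumr_const card_ord -mulr_natr; ring.
rewrite -!big_split/=; apply: eq_bigr => i _.
rewrite (@partial_eq_on _ _ U _ (cst 2 * (crd i * f) + sqn * partial i f))//.
  rewrite partial_add ?partial_mul; try solve_class_C; try done.
  rewrite partial_cst partial_crd partial_sqn eqxx mulrfctE /= /crd.
  by ring.
move=> y Uy; rewrite partial_mul; try solve_class_C; try done.
rewrite partial_sqn.
transitivity (2 * (y 0 i * f y) + sqn y * partial i f y) => //.
by ring.
Qed.

Lemma partial_comm f i j x : class_C 2 U f -> U x ->
  partial i (partial j f) x = partial j (partial i f) x.
Proof.
move=> cf Ux; apply: derive_comm.
- near=> y; have Uy : U y by near: y; exact: (open_nbhs_nbhs (conj oU Ux)).
  by split; apply: diff_derivable; apply: class_C_differentiable Uy;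
     [exact: cf|exact: cf|exact: class_C_partial cf|exact: class_C_partial cf].
- exact: (class_C_continuous (class_C_partial j (class_C_partial i cf)) Ux).
- exact: (class_C_continuous (class_C_partial i (class_C_partial j cf)) Ux).
Unshelve. all: by end_near. Qed.

(** The relation [d_i, E] = d_i. The extra term comes from differentiating the coefficient y_i of
    [euler]; the rest is the symmetry of second derivatives. *)
Lemma partial_euler f i x : class_C 2 U f -> U x ->
  partial i (euler f) x = partial i f x + euler (partial i f) x.
Proof.
move=> cf Ux; rewrite partial_sum//; last by move=> l; solve_class_C.
rewrite -[partial i f x](sum_delta i (fun j => partial j f x)).
rewrite eulerE -big_split/=; apply: eq_bigr => j _.
rewrite partial_mul ?partial_crd//; try solve_class_C.
by rewrite (partial_comm i j cf Ux) eq_sym /= /crd; ring.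
Qed.

(** Moving each of the two derivatives d_i past E by [partial_euler] leaves one copy of d_i d_i f,
    hence the factor 2. *)
Lemma laplacian_euler f x : class_C 3 U f -> U x ->
  laplacian (euler f) x = euler (laplacian f) x + 2 * laplacian f x.
Proof.
move=> cf Ux; rewrite !laplacianE laplacian_sum euler_sum//; last first.
  by move=> l; solve_class_C.
rewrite mulr_sumr -big_split/=; apply: eq_bigr => i _.
rewrite (@partial_eq_on _ _ U _ (partial i f + euler (partial i f)))//;
  last first.
  by move=> y; apply: partial_euler; solve_class_C.
rewrite partial_add ?partial_euler//; try solve_class_C.
by ring.
Qed.

End OperatorIdentities.

(** * Pulling back by the inversion *)

Section Conformal.
Context {R : realType} {n : nat}.
Notation V := 'rV[R]_n.
Implicit Types (f g : V -> R) (x y : V) (i j : 'I_n).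

(** A sum with the coefficient [cst (- 2)], instead of a difference, keeps the body within the
    shapes that [solve_class_C] recognizes. *)
Definition special_conformal i f : V -> R :=
  sqn * partial i f + cst (- 2) * (crd i * euler f).

Definition inverted_laplacian f : V -> R :=
  sqn * (sqn * laplacian f) + cst (4 - 2 * n%:R) * (sqn * euler f).

Lemma special_conformalE i f x :
  special_conformal i f x = sqn x * partial i f x - 2 * (x 0 i * euler f x).
Proof. by rewrite -mulNr. Qed.

Lemma inverted_laplacianE f x : inverted_laplacian f x =
  sqn x * (sqn x * laplacian f x) + (4 - 2 * n%:R) * (sqn x * euler f x).
Proof. by []. Qed.

Variable U : set V.
Hypothesis oU : open U.

Lemma class_C_special_conformal k i f : class_C k.+1 U f ->
  class_C k U (special_conformal i f).
Proof. by move=> cf; rewrite /special_conformal; solve_class_C. Qed.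

Lemma class_C_inverted_laplacian k f : class_C k.+2 U f ->
  class_C k U (inverted_laplacian f).
Proof. by move=> cf; rewrite /inverted_laplacian; solve_class_C. Qed.

Lemma sum_special_conformal2 f x : class_C 2 U f -> U x ->
  \sum_(i < n) special_conformal i (special_conformal i f) x =
  inverted_laplacian f x.
Proof.
move=> cf Ux.
(* The terms in y_i d_i f cancel, and E d_i f has been turned into d_i E f - d_i f, so that
   summation over i produces only Lap f, E f, E E f and s. The two multiples of s E E f then cancel,
   and s E f keeps the coefficient 4 - 2 n. *)
transitivity (\sum_(i < n) (sqn x ^+ 2 * partial i (partial i f) x
    - 2 * (sqn x * euler f x) - 4 * sqn x * (x 0 i * partial i (euler f) x)
    + 4 * (euler f x + euler (euler f) x) * x 0 i ^+ 2)).
  apply: eq_bigr => i _; rewrite special_conformalE /special_conformal.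
  rewrite (partial_add (U := U)) ?(euler_add (U := U))//; try solve_class_C.
  rewrite !(partial_mul (U := U)) ?(euler_mul (U := U))//; try solve_class_C.
  rewrite partial_cst euler_cst partial_crd euler_crd partial_sqn euler_sqn.
  rewrite (partial_euler oU i cf Ux) !mulrfctE eqxx/= /crd.
  by ring.
rewrite !big_split/= -!mulr_sumr !sumrN -!mulr_sumr sumr_const card_ord.
rewrite -laplacianE -eulerE -sqnE inverted_laplacianE -mulr_natr.
by ring.
Qed.

Lemma inverted_laplacian2 f x : class_C 4 U f -> U x ->
  inverted_laplacian (inverted_laplacian f) x =
  sqn x ^+ 4 * laplacian (laplacian f) x + (4 - n%:R) *
  (4 * sqn x ^+ 3 * euler (laplacian f) x + 8 * sqn x ^+ 3 * laplacian f x +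
   2 * (4 - 2 * n%:R) * sqn x ^+ 2 * (euler (euler f) x + euler f x)).
Proof.
move=> cf Ux; rewrite inverted_laplacianE /inverted_laplacian.
rewrite (laplacian_add (U := U)) ?(euler_add (U := U))//; try solve_class_C.
rewrite (laplacian_scale oU) ?(laplacian_sqn_mul oU)//; try solve_class_C.
rewrite (laplacian_euler oU)//; try solve_class_C.
rewrite !(euler_mul (U := U))//; try solve_class_C.
rewrite !euler_sqn euler_cst !mulrfctE /cst.
(* Once the commutators are expanded, these six values may be treated as independent variables: the
   claim is a polynomial identity in them and [n]. *)
move: (laplacian (laplacian f) x) (euler (laplacian f) x) (euler (euler f) x).
move: (laplacian f x) (euler f x) (sqn x) => a b c d e h.
by ring.
Qed.

End Conformal.

(** * The inversion: differentiability, Jacobian and chain rule *)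

Section Inversion.
Context {R : realType} {n : nat}.
Notation V := 'rV[R]_n.
Implicit Types (f g : V -> R) (x y : V) (i j : 'I_n).

Lemma sqn_ge0 x : 0 <= sqn x.
Proof. by rewrite sqnE sumr_ge0// => i _; exact: sqr_ge0. Qed.

Lemma sqn_neq0 x : x <> 0 -> sqn x != 0.
Proof.
apply: contra_not_neq => /eqP; rewrite sqnE psumr_eq0; last first.
  by move=> i _; exact: sqr_ge0.
move=> /allP x0; apply/rowP => i; rewrite mxE.
by apply/eqP; rewrite -sqrf_eq0; exact: (implyP (x0 i (mem_index_enum i))).
Qed.

Lemma sqnZ (a : R) x : sqn (a *: x) = a ^+ 2 * sqn x.
Proof.
by rewrite !sqnE mulr_sumr; apply: eq_bigr => i _; rewrite mxE exprMn.
Qed.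

Lemma inversionE x : inversion x = (sqn x)^-1 *: x.
Proof. by rewrite /inversion /enorm -sqnE sqr_sqrtr// sqn_ge0. Qed.

Lemma sqn_inversion x : x <> 0 -> sqn (inversion x) = (sqn x)^-1.
Proof.
move=> /sqn_neq0 x0; rewrite inversionE sqnZ expr2 -mulrA mulVf// mulr1.
by [].
Qed.

Lemma differentiable_inversion x : x <> 0 -> differentiable (@inversion R n) x.
Proof.
(* Decomposition along the standard basis reduces the claim to scalar rational functions with
   denominator [sqn]. *)
move=> x0; have -> : @inversion R n =
    \sum_(k < n) (fun y : V => ((sqn y)^-1 * y 0 k) *: (delta_mx 0 k : V)).
  apply/funext => y; rewrite fct_sumE inversionE [X in _ *: X = _]row_sum_delta.
  by rewrite scaler_sumr; apply: eq_bigr => k _; rewrite scalerA.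
apply: differentiable_sum => k; apply: differentiableZl.
apply: differentiableM; last exact: differentiable_coord.
apply: differentiableV; last exact: sqn_neq0.
have cs : class_C 1 [set: V] (@sqn R n) by apply: class_C_sqn; exact: openT.
exact: (class_C_differentiable cs).
Qed.

Lemma derive_inversion i x : x <> 0 -> 'D_(delta_mx 0 i) (@inversion R n) x =
  (sqn x)^-1 *: delta_mx 0 i - (2 * x 0 i / sqn x ^+ 2) *: x.
Proof.
move=> x0; have dphi := differentiable_inversion x0.
have s0 := sqn_neq0 x0.
rewrite derive_mx; last exact: diff_derivable.
apply/rowP => k; rewrite mxE.
have -> : (fun y : V => inversion y 0 k) = (fun y => (sqn y)^-1) * crd k.
  by apply/funext => y; rewrite inversionE mxE.
have dsV : is_derive x (delta_mx 0 i : V) (fun y => (sqn y)^-1)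
    (- sqn x ^- 2 *: (2 * x 0 i)).
  have [ds dsE] := is_derive_sqn i x.
  by split; [exact: derivableV|rewrite deriveV// dsE].
have [_ ->] := is_deriveM dsV (is_derive_crd k x (delta_mx 0 i)).
rewrite !mxE /GRing.scale/= /crd.
by move: (sqn x) s0 => s s0; field.
Qed.

(** Write y for the image of x, so that |y|^2 = 1 / |x|^2 and x = y / |y|^2. The i-th derivative of
    the inversion, rewritten in y, is |y|^2 e_i - 2 y_i y; the differential of f along the position
    vector y is E f. *)
Lemma partial_comp_inversion f i x : x <> 0 -> differentiable f (inversion x) ->
  partial i (f \o @inversion R n) x = special_conformal i f (inversion x).
Proof.
move=> x0 df; have dphi := differentiable_inversion x0.
have s0 := sqn_neq0 x0.
rewrite /partial deriveE; last exact: differentiable_comp.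
rewrite diff_comp// [LHS]/= -(deriveE _ dphi) derive_inversion//.
rewrite linearB !linearZ/= special_conformalE sqn_inversion//.
rewrite -[in RHS]/(partial i f (inversion x)) /partial deriveE//.
(* E f is the differential applied to the position vector, here x / |x|^2. *)
have -> : euler f (inversion x) = (sqn x)^-1 * 'd f (inversion x) x.
  transitivity ('d f (inversion x) (inversion x)); last first.
    by rewrite [X in 'd f _ X]inversionE linearZ.
  rewrite eulerE [X in _ = 'd _ _ X]row_sum_delta linear_sum.
  by apply: eq_bigr => k _; rewrite linearZ /= /partial deriveE.
rewrite inversionE mxE -inversionE /GRing.scale/=.
move: (sqn x) s0 ('d f (inversion x) x) ('d f (inversion x) (delta_mx 0 i)).
by move=> s s0 a b; field.
Qed.

End Inversion.

(** * Regularity and iterated Laplacian of functions pulled back by the inversion *)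

Section CompInversion.
Context {R : realType} {n : nat} {U : set 'rV[R]_n}.
Hypothesis oU : open U.
Notation V := 'rV[R]_n.
Notation phi := (@inversion R n).
Notation W := ([set x : V | x <> 0] `&` phi @^-1` U).
Implicit Types (f : V -> R) (x : V).

Lemma continuous_inversion x : x <> 0 -> {for x, continuous phi}.
Proof.
by move=> x0; exact/differentiable_continuous/differentiable_inversion.
Qed.

Lemma open_preimage_inversion : open W.
Proof.
rewrite openE => x [x0 Ux]; apply: filterI.
  suff : open [set y : V | y <> 0] by rewrite openE; apply.
  have -> : [set y : V | y <> 0] = ~` [set 0] by [].
  by apply: closed_openC; apply: accessible_closed_set1;
    exact: hausdorff_accessible.
exact: (continuous_inversion x0 (open_nbhs_nbhs (conj oU Ux))).
Qed.

(** A partial derivative of the pullback is the pullback of [special_conformal i f], which is one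
    order less regular than [f]. Induction over all [f] thus uses only the first derivatives of the
    inversion. *)
Lemma class_C_comp_inversion k f : class_C k U f -> class_C k W (f \o phi).
Proof.
elim: k f => [|k IH] f cf.
  move=> x /set_mem[x0 Ux]; apply: continuous_comp.
    exact: continuous_inversion.
  exact: class_C_continuous cf Ux.
have df x : W x -> differentiable f (phi x).
  by move=> [_ Ux]; exact: class_C_differentiable cf Ux.
split=> [x Wx|i].
  apply: differentiable_comp (df x Wx).
  by apply: differentiable_inversion; case: Wx.
apply: (@class_C_eq_on _ _ _ _ (special_conformal i f \o phi)).
- exact: open_preimage_inversion.
- by move=> x Wx; exact/esym/(partial_comp_inversion i Wx.1 (df x Wx)).
- exact/IH/class_C_special_conformal.
Qed.

(** The chain rule is applied twice for each i, the inner time as an identity on the open set [W],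
    so that it may be differentiated again. *)
Lemma laplacian_comp_inversion f x : class_C 2 U f -> W x ->
  laplacian (f \o phi) x = inverted_laplacian f (phi x).
Proof.
move=> cf [x0 Ux]; rewrite laplacianE -(sum_special_conformal2 oU cf Ux).
apply: eq_bigr => i _.
have dc : differentiable (special_conformal i f) (phi x).
  exact: class_C_differentiable (class_C_special_conformal oU i cf) Ux.
rewrite -(partial_comp_inversion i x0 dc).
apply: (@partial_eq_on _ _ W _ _ _ _ open_preimage_inversion) => // y [y0 Uy].
exact: partial_comp_inversion y0 (class_C_differentiable cf Uy).
Qed.

Lemma bilaplacian_comp_inversion f x : class_C 4 U f -> W x ->
  laplacian (laplacian (f \o phi)) x =
  inverted_laplacian (inverted_laplacian f) (phi x).
Proof.
move=> cf Wx; transitivity (laplacian (inverted_laplacian f \o phi) x).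
  apply: (laplacian_eq_on open_preimage_inversion _ Wx) => y Wy.
  exact: (laplacian_comp_inversion (class_C_le _ cf) Wy).
exact: (laplacian_comp_inversion (class_C_inverted_laplacian oU cf) Wx).
Qed.

End CompInversion.

(** * A biharmonic test function that detects the dimension *)

Section SqnCrd.
Context {R : realType} {n : nat}.
Notation V := 'rV[R]_n.
Implicit Types (i : 'I_n) (x : V).

Lemma sqn_delta i : sqn (delta_mx 0 i : V) = 1.
Proof.
rewrite sqnE -[RHS](sum_delta i (fun=> 1)); apply: eq_bigr => j _.
by rewrite mxE eqxx/= mul1r; case: eqP; rewrite ?expr1n ?expr0n.
Qed.

Lemma laplacian_sqn : laplacian (@sqn R n) = cst (2 * n%:R).
Proof.
apply/funext => x; rewrite laplacianE.
transitivity (\sum_(i < n) (2 : R)).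
  apply: eq_bigr => i _.
  have -> : partial i (@sqn R n) = cst 2 * crd i.
    by apply/funext => y; rewrite partial_sqn.
  rewrite (partial_mul (U := setT))//; [|exact: class_C_cst|exact: class_C_crd].
  by rewrite partial_cst partial_crd eqxx/= mulr0 addr0 mulr1.
by rewrite sumr_const card_ord /cst mulr_natr.
Qed.

Lemma laplacian_crd i : laplacian (@crd R n i) = cst 0.
Proof.
by apply/funext => x; rewrite laplacianE big1// => j _;
   rewrite partial_crd partial_cst.
Qed.

Lemma laplacian_cst (a : R) : laplacian (cst a : V -> R) = cst 0.
Proof.
by apply/funext => x; rewrite laplacianE big1// => j _; rewrite !partial_cst.
Qed.

Lemma laplacian_sqn_crd i :
  laplacian (@sqn R n + crd i) = cst (2 * n%:R).
Proof.
have oT : open [set: V] by exact: openT.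
apply/funext => y; rewrite (laplacian_add (U := setT))//; try solve_class_C.
by rewrite laplacian_sqn laplacian_crd /cst addr0.
Qed.

Lemma biharmonic_sqn_crd i : biharmonic setT (@sqn R n + crd i).
Proof.
have oT : open [set: V] by exact: openT.
split=> [|x _]; first by solve_class_C.
by rewrite laplacian_sqn_crd laplacian_cst.
Qed.

(** At e_i, the function s alone gives 8 (4 - n) (6 - n) and y_i alone gives 8 (4 - n) (2 - n), with
    spurious zeros at n = 6 and n = 2. Their sum vanishes only at n = 4. *)
Lemma inverted_laplacian2_sqn_crd i :
  inverted_laplacian (inverted_laplacian (@sqn R n + crd i)) (delta_mx 0 i) =
  16 * (4 - n%:R) ^+ 2.
Proof.
have oT : open [set: V] by exact: openT.
have [cw w0] := biharmonic_sqn_crd i.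
rewrite (inverted_laplacian2 oT cw I) (w0 _ I).
have ew : euler (@sqn R n + crd i) = cst 2 * sqn + crd i.
  apply/funext => y; rewrite (euler_add (U := setT))//; try solve_class_C.
  by rewrite euler_sqn euler_crd.
have sE := sqn_delta i.
have cE : (delta_mx 0 i : V) 0 i = 1 by rewrite mxE !eqxx.
rewrite laplacian_sqn_crd ew (euler_add (U := setT))//; try solve_class_C.
rewrite (euler_mul (U := setT))//; try solve_class_C.
rewrite !euler_cst euler_sqn euler_crd !mulr0 !addr0 ?add0r.
have -> : (cst 2 * sqn + crd i) (delta_mx 0 i : V) =
    2 * sqn (delta_mx 0 i : V) + (delta_mx 0 i : V) 0 i by [].
rewrite sE cE /cst.
by ring.
Qed.

End SqnCrd.

Theorem theorem2 (R : realType) (n : nat) (hn : (0 < n)%N) :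
  biharmonic_morphism [set x : 'rV[R]_n | x <> 0%R] [set: 'rV[R]_n]
    (@inversion R n) <-> n = 4%N.
Proof.
split=> [[_ _ bm]|n4].
  (* Positivity of [n] provides a basis vector. It lies on the unit sphere, hence is fixed by the
     inversion, and the test function can be evaluated at [e] itself. *)
  pose i := Ordinal hn; pose e : 'rV[R]_n := delta_mx 0 i.
  have e0 : e <> 0
    by move/rowP/(_ i); rewrite !mxE !eqxx => /eqP; rewrite oner_eq0.
  have se : sqn e = 1 by exact: sqn_delta.
  have phie : inversion e = e by rewrite inversionE se invr1 scale1r.
  have oT : open [set: 'rV[R]_n] by exact: openT.
  have bw := @biharmonic_sqn_crd R n i.
  have We : ([set x | x <> 0] `&` @inversion R n @^-1` setT) e by [].
  have [_ /(_ e We)] := bm _ _ oT (@subsetT _ _) bw (ex_intro _ e We).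
  rewrite (bilaplacian_comp_inversion oT bw.1 We) phie.
  rewrite inverted_laplacian2_sqn_crd.
  move=> /eqP; rewrite mulf_eq0 sqrf_eq0 pnatr_eq0/= subr_eq0 eqr_nat.
  by move=> /eqP.
split=> // [|U f oU _ [cf bf] _].
  apply: continuous_in_subspaceT => x /set_mem; exact: continuous_inversion.
split; first exact: (class_C_comp_inversion oU cf).
move=> x Wx; have [_ Ux] := Wx.
rewrite (bilaplacian_comp_inversion oU cf Wx).
rewrite (inverted_laplacian2 oU cf Ux) (bf _ Ux).
(* The factor 4 - n kills every term but s^4 Lap^2 f, which is zero by biharmonicity. *)
have -> : n%:R = 4 :> R by rewrite n4.
by rewrite subrr mulr0 mul0r addr0.
Qed.
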